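(* Let $r,t$ be integers with $r\geq 3$ and $t$ odd. Then $$\operatorname{gr}_4(P_5:S_t^r)= \begin{cases} \frac{3t-5}{2}, & \text{if } 3\leq r\leq \left\lfloor\frac{t-1}{4}\right\rfloor;\\ t+2r-2, & \text{if } \left\lceil\frac{t-1}{4}\right\rceil\leq r\leq \frac{t-3}{2}. \end{cases}$$
   Context: All graphs are finite, simple and undirected. $K_n$ is the complete graph on $n$ vertices and $P_5$ is the path with $5$ vertices and $4$ edges. $S_t^r$ is the graph of order $t$ obtained from the star $K_{1,t-1}$ by adding $r$ pairwise independent edges between the leaves, so that it has $r$ triangles (sharing the center) and $t-2r-1$ pendent edges. A $k$-edge-coloring assigns to each edge one of $k$ colors; all $k$-edge-colorings are assumed exact, i.e. each of the $k$ colors is used at least once. An edge-colored graph is rainbow if all its edges have different colors and monochromatic if all its edges have a single color. A copy of a graph means a (not necessarily induced) subgraph isomorphic to it. For non-empty graphs $G,H$ (graphs with at least one edge) and a positive integer $k$, the Gallai-Ramsey number $\operatorname{gr}_k(G:H)$ is the minimum integer $N$ with $\binom{N}{2}\geq k$ (so that $K_N$ admits a $k$-edge-coloring) such that for all $n\geq N$, every $k$-edge-coloring of $K_n$ contains either a rainbow copy of $G$ or a monochromatic copy of $H$. *)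

(* Defs.v *)
From mathcomp Require Import all_boot.

Set Implicit Arguments.
Unset Strict Implicit.
Unset Printing Implicit Defensive.

(* Finite simple undirected graphs. *)
Record sgraph := SGraph {
  vertex :> finType;
  adj : rel vertex;
  adj_sym : symmetric adj;
  adj_irrefl : irreflexive adj }.

Section SymmetricClosure.
Variables (T : finType) (e : rel T).
Hypothesis e_irrefl : irreflexive e.

Definition sym_adj : rel T := fun x y => e x y || e y x.

Lemma sym_adj_sym : symmetric sym_adj.
Proof. by move=> x y; rewrite /sym_adj orbC. Qed.

Lemma sym_adj_irrefl : irreflexive sym_adj.
Proof. by move=> x; rewrite /sym_adj e_irrefl. Qed.

Definition sym_graph : sgraph := SGraph sym_adj_sym sym_adj_irrefl.
End SymmetricClosure.

Section Complete.
Variable n : nat.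

Definition complete_adj : rel 'I_n := fun x y => x != y.

Lemma complete_adj_sym : symmetric complete_adj.
Proof. by move=> x y; rewrite /complete_adj eq_sym. Qed.

Lemma complete_adj_irrefl : irreflexive complete_adj.
Proof. by move=> x; rewrite /complete_adj eqxx. Qed.

Definition complete_graph : sgraph :=
  SGraph complete_adj_sym complete_adj_irrefl.
End Complete.

Section Path.
Variable n : nat.

Definition path_arc : rel 'I_n := fun x y => y == x.+1 :> nat.

Lemma path_arc_irrefl : irreflexive path_arc.
Proof. by move=> x; rewrite /path_arc ltn_eqF. Qed.

Definition path_graph : sgraph := sym_graph path_arc_irrefl.
End Path.

(* S_t^r on the vertices 0, ..., t-1: the centre is 0, and the r independent
   edges between leaves are {1,2}, {3,4}, ..., {2r-1,2r}. This is the intended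
   graph only when 2r <= t-1; otherwise some of these edges do not exist. *)
Section StarTriangles.
Variables t r : nat.

Definition star_arc : rel 'I_t := fun x y =>
  ((x == 0 :> nat) && (y != 0 :> nat))
  || [exists i : 'I_r, (x == i.*2.+1 :> nat) && (y == i.*2.+2 :> nat)].

Lemma star_arc_irrefl : irreflexive star_arc.
Proof.
move=> x; rewrite /star_arc andbN /=; apply/existsP => -[i /andP[/eqP-> /eqP]].
by move/eqP; rewrite ltn_eqF.
Qed.

Definition star_graph : sgraph := sym_graph star_arc_irrefl.
End StarTriangles.

(* A k-edge-coloring is a function of ordered pairs of vertices that is
   symmetric on edges; its values on non-adjacent pairs are never used. *)
Definition edge_coloring (G : sgraph) (k : nat) (c : G -> G -> 'I_k) : Prop :=
  forall x y, adj x y -> c x y = c y x.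

Definition exact_coloring (G : sgraph) (k : nat) (c : G -> G -> 'I_k) : Prop :=
  edge_coloring c /\ forall i : 'I_k, exists x y, adj x y /\ c x y = i.

(* Not necessarily induced. *)
Definition is_copy (H G : sgraph) (f : H -> G) : Prop :=
  injective f /\ forall x y, adj x y -> adj (f x) (f y).

Definition has_rainbow_copy (H G : sgraph) (k : nat) (c : G -> G -> 'I_k) :
    Prop :=
  exists f : H -> G, is_copy f /\
    forall x y u v, adj x y -> adj u v ->
      c (f x) (f y) = c (f u) (f v) -> [set x; y] = [set u; v].

Definition has_mono_copy (H G : sgraph) (k : nat) (c : G -> G -> 'I_k) :
    Prop :=
  exists f : H -> G, is_copy f /\
    exists i : 'I_k, forall x y, adj x y -> c (f x) (f y) = i.

Definition gallai_ramsey_bound (k : nat) (G H : sgraph) (N : nat) : Prop :=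
  k <= 'C(N, 2) /\
  forall n, N <= n ->
  forall c : complete_graph n -> complete_graph n -> 'I_k,
    exact_coloring c -> has_rainbow_copy G c \/ has_mono_copy H c.

(* gr_k(G : H) = N. *)
Definition is_gallai_ramsey (k : nat) (G H : sgraph) (N : nat) : Prop :=
  gallai_ramsey_bound k G H N /\
  forall M, gallai_ramsey_bound k G H M -> N <= M.

Definition ceil_div (m d : nat) : nat := (m + d.-1) %/ d.

(* Main.v *)
Require Import Defs.
From mathcomp Require Import all_boot.
From mathcomp Require Import zify.

(* Write t = 2s+1; the claimed value is N = max(3s-1, 2s+2r-1), and r <= s-1.

   Upper bound.  Take a 4-colouring of K_n, n >= N, without rainbow P_5.

   If some vertex v has edges va, vb, ve of three colours, then at most four
   vertices can be deleted to leave a monochromatic clique, which has at least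
   n - 4 >= t vertices.  Call an edge xy disjoint from {v, a, b, e} free if it
   has the fourth colour.  Given a free edge, no two adjacent edges outside
   {v, a, b, e} can have different colours, one of them being the fourth, so
   K_n - {v, a, b, e} is monochromatic.  If there is never a free edge, v does
   not see the fourth colour, and each edge xy of that colour contains all the
   neighbours of v of some colour; if these are {x, y} one finds a rainbow P_5,
   and if they are {x} then K_n - {v, x, y} is monochromatic.

   If every vertex sees at most two colours, the palettes of the vertices
   pairwise meet, hence have a common colour i0; the other three colours live
   inside three parts A, B, C, where |A| <= |B| <= |C|, and all edges between
   parts have colour i0.  A vertex of A is joined in colour i0 to B and C,
   at least 2s vertices.  Either C contains r - |B| independent edges of colour
   i0, and together with edges between B and C they give the triangles of a
   star of colour i0, or C contains a clique with t vertices of the other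
   colour.

   Lower bound.  Split N - 1 vertices in three parts, give each part its own
   colour and use the fourth colour between the parts; the part sizes are
   s, s-1, s-1 or r-1, r-1, 2s. *)

Set Implicit Arguments.
Unset Strict Implicit.
Unset Printing Implicit Defensive.

(** * Vertices seeing three colours *)

(** Stated over any [eqType] of colours, so that it serves both for colours in ['I_4] and for their
    numerical labels. *)
Definition rainbow_P5_free (T K : eqType) (c : T -> T -> K) : Prop :=
  forall p q r s u, uniq [:: p; q; r; s; u] ->
    ~~ uniq [:: c p q; c q r; c r s; c s u].

Ltac split_neq := rewrite /= ?inE ?negb_or ?andbT;
  repeat match goal with |- is_true (_ && _) => apply/andP; split end.

(** Extracts from a [uniq] or non-membership hypothesis each disequality in both orientations, so
    that side conditions close by [assumption]. *)
Ltac neqs H := move: (H); rewrite /= ?inE ?negb_or ?andbT;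
  repeat match goal with
  | |- is_true (_ && _) -> _ => case/andP
  | |- is_true (?x != ?y) -> _ =>
      let h := fresh "ne" in
      move=> h; have := h; rewrite eq_sym; let h' := fresh "ne" in move=> h'
  end.

Section FourColours.
Variables (T : finType) (d : T -> T -> nat).
Hypothesis dC : forall x y, d x y = d y x.
Hypothesis d4 : forall x y, d x y < 4.
Hypothesis dfree : rainbow_P5_free d.

Lemma not_rainbow p q r s u : uniq [:: p; q; r; s; u] ->
  d p q = d q r \/ d p q = d r s \/ d p q = d s u \/
  d q r = d r s \/ d q r = d s u \/ d r s = d s u.
Proof. by move=> /dfree; rewrite /= !inE; lia. Qed.

Ltac close := clear dC d4 dfree;
  repeat match goal with H : is_true _ |- _ => clear H end;
  solve [congruence | left; congruence | right; congruence].
Ltac prune := lazymatch goal with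
  | |- (_ \/ _) -> _ => case; prune
  | |- (_ = _) -> _ => let h := fresh "eq" in intro h; try close
  end.
(* [path p q r s u] splits on which two edges of the path p-q-r-s-u share their
   colour and discards the cases refuted by the colours already known. *)
Ltac path p q r s u :=
  have := @not_rainbow p q r s u;
  (have -> : uniq [:: p; q; r; s; u] by split_neq; assumption);
  move: (dC p q) (dC q r) (dC r s) (dC s u) => ? ? ? ?;
  move=> /(_ isT); prune.

(** Paths through [v] force the colours of [by] and [ey] and leave two choices for each of [zb],
    [ze] and [be]; every one of the eight combinations contains a rainbow path. *)
Lemma two_colours_outside_false v a b e x y z :
  uniq [:: v; a; b; e; x; y; z] ->
  d v a = 1 -> d v b = 2 -> d v e = 3 -> d x y = 0 -> d y z = 1 -> False.
Proof.
move=> U va vb ve xy yz.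
neqs U => *.
have by2 : d b y = 2.
  by path e v b y x; path a v b y x; path e v b y z.
have ey3 : d e y = 3.
  by path b v e y x; path a v e y x; path b v e y z.
have zb : d z b = 1 \/ d z b = 2.
  by path e v b z y; path x y z b v.
have ze : d z e = 1 \/ d z e = 3.
  by path b v e z y; path x y z e v.
have be : d b e = 2 \/ d b e = 3.
  by path x y b e v; path z y b e v.
by case: zb => zb; case: ze => ze; case: be => be;
  first [by path x y e z b | by path x y b z e | by path x y z b e | by path x y z e b
        | by path x y e b z | by path x y b e z].
Qed.

Hypothesis no_free_edge : forall v a b e x y, uniq [:: v; a; b; e; x; y] ->
  ~~ uniq [:: d v a; d v b; d v e; d x y].

Lemma cross_neq0 v a b e x y : uniq [:: v; a; b; e; x; y] ->
  d v a = 1 -> d v b = 2 -> d v e = 3 -> d x y = 1 \/ d x y = 2 \/ d x y = 3.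
Proof.
move=> /no_free_edge + va vb ve; rewrite va vb ve /= !inE.
by case: (d x y) (d4 x y) => [|[|[|[|]]]] //; tauto.
Qed.

(* [transv v a b e x y] does the same with the colours left to the edge xy when
   va, vb, ve have colours 1, 2, 3. *)
Ltac transv v a b e x y :=
  have := @cross_neq0 v a b e x y;
  (have -> : uniq [:: v; a; b; e; x; y] by split_neq; assumption);
  move: (dC x y) => ?;
  move=> /(_ isT ltac:(congruence) ltac:(congruence) ltac:(congruence)); prune.
Ltac range x y :=
  have : d x y = 0 \/ d x y = 1 \/ d x y = 2 \/ d x y = 3
    by case: (d x y) (d4 x y) => [|[|[|[|]]]] //; tauto.

(** Call class i of [v] the set of vertices joined to [v] in colour i. Edges from class 2 to [e]
    have colour 0 or 1, so two of the three agree; [be0] and [be1] exclude either agreement. *)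
Lemma class_pair_false v a y b1 b2 b3 e :
  uniq [:: v; a; y; b1; b2; b3; e] -> d a y = 0 -> d v a = 1 -> d v y = 1 ->
  d v b1 = 2 -> d v b2 = 2 -> d v b3 = 2 -> d v e = 3 -> False.
Proof.
move=> U ay va vy vb1 vb2 vb3 ve.
neqs U => *.
have bb b b' b'' : uniq [:: v; a; y; b; b'; b''; e] ->
    d v b = 2 -> d v b' = 2 -> d v b'' = 2 -> d b b' = 1 \/ d b b' = 2.
  move=> W vb vb' vb''; neqs W => *.
  (* The third vertex of class 2 is the leaf of colour 2 of a star disjoint from the edge; this is
     why three such vertices are needed. *)
  by transv v a b'' e b b'; path y a v b b'.
have be0 b b' b'' : uniq [:: v; a; y; b; b'; b''; e] ->
    d v b = 2 -> d v b' = 2 -> d v b'' = 2 -> d b e = 0 -> d b' e = 0 -> False.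
  move=> W vb vb' vb'' be b'e; neqs W => *.
  case: (bb b b' b'') => //; try (by split_neq); path a v e b b' => bb'.
  by case: (bb b' b'' b) => //; try (by split_neq);
    [path b'' b' v e b | path a v e b' b''].
have be1 b b' b'' : uniq [:: v; a; y; b; b'; b''; e] ->
    d v b = 2 -> d v b' = 2 -> d v b'' = 2 -> d b e = 1 -> d b' e = 1 -> False.
  move=> W vb vb' vb'' be b'e; neqs W => *.
  have ab : d a b = 3.
    by transv v y b' e a b; path y a b v e; path y a b e v.
  have bb' : d b b' = 1.
    by case: (bb b b' b'') => //; try (by split_neq); path y a b b' e.
  by path y a b b' v.
have be01 b b' : uniq [:: v; a; y; b; b'; e] -> d v b = 2 -> d v b' = 2 ->
  d b e = 0 \/ d b e = 1.
  move=> W vb vb'; neqs W => *.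
  by range b e; path y a v b e; path y a v e b.
have s1 : d b1 e = 0 \/ d b1 e = 1 by apply: (be01 b1 b2) => //; split_neq.
have s2 : d b2 e = 0 \/ d b2 e = 1 by apply: (be01 b2 b1) => //; split_neq.
have s3 : d b3 e = 0 \/ d b3 e = 1 by apply: (be01 b3 b1) => //; split_neq.
case: s1 s2 s3 => e1 [] e2 [] e3;
  first [ by apply: (be0 b1 b2 b3) => //; split_neq
        | by apply: (be0 b1 b3 b2) => //; split_neq
        | by apply: (be0 b2 b3 b1) => //; split_neq
        | by apply: (be1 b1 b2 b3) => //; split_neq
        | by apply: (be1 b1 b3 b2) => //; split_neq
        | by apply: (be1 b2 b3 b1) => //; split_neq].
Qed.

(** * An edge of colour 0 between class 1 and class 2 *)

Section CrossPair.
Variables v a y : T.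
Hypotheses (ay : d a y = 0) (va : d v a = 1) (vy : d v y = 2).

Lemma class3_edge e z : uniq [:: v; a; y; e; z] -> d v e = 3 ->
  d e z = 0 \/ d e z = 3.
Proof.
move=> U ve; neqs U => *.
by range e z; path y a v e z; path a y v e z.
Qed.

Lemma class2_edge b z : uniq [:: v; a; y; b; z] -> d v b = 2 -> d b z <> 3.
Proof. by move=> U vb; neqs U => *; path y a v b z. Qed.

Lemma class23_edge b e : uniq [:: v; a; y; b; e] -> d v b = 2 -> d v e = 3 ->
  d b e = 0.
Proof.
move=> W vb ve; neqs W => *.
have : d b e <> 3 by apply: class2_edge => //; split_neq.
have : d e b = 0 \/ d e b = 3 by apply: class3_edge => //; split_neq.
by rewrite (dC e b); case.
Qed.

(** The edge [be] has colour 0 and avoids the star with centre [v] and leaves [a], [y], [e'], so it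
    would be free. *)
Lemma class23_false b e e' : uniq [:: v; a; y; b; e; e'] ->
  d v b = 2 -> d v e = 3 -> d v e' = 3 -> False.
Proof.
move=> W vb ve ve'; neqs W => *.
have be : d b e = 0 by apply: class23_edge => //; split_neq.
by transv v a y e' b e.
Qed.

(** The edges from class 2 to [e] have colour 0, which forces colour 1 on [b1 b2] and [b2 b3]; then
    [b3 b2 v e b1] is rainbow. *)
Lemma class223_false b1 b2 b3 e : uniq [:: v; a; y; b1; b2; b3; e] ->
  d v b1 = 2 -> d v b2 = 2 -> d v b3 = 2 -> d v e = 3 -> False.
Proof.
move=> W vb1 vb2 vb3 ve; neqs W => *.
have be1 : d b1 e = 0 by apply: class23_edge => //; split_neq.
have be2 : d b2 e = 0 by apply: class23_edge => //; split_neq.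
have bb1 : d b1 b2 = 1.
  have : d b1 b2 <> 3 by apply: class2_edge => //; split_neq.
  by transv v a y e b1 b2; path a v e b1 b2.
have bb2 : d b2 b3 = 1.
  have : d b2 b3 <> 3 by apply: class2_edge => //; split_neq.
  by transv v a y e b2 b3; path a v e b2 b3.
by path b3 b2 v e b1.
Qed.

Lemma class33_edge e e' e'' : uniq [:: v; a; y; e; e'; e''] ->
  d v e = 3 -> d v e' = 3 -> d v e'' = 3 -> d e e' = 3.
Proof.
move=> U ve ve' ve''; neqs U => *.
by transv v a y e'' e e'; path y a v e e'; path a y v e e'.
Qed.
End CrossPair.
End FourColours.

Definition mono_outside (T : finType) (K : eqType) (c : T -> T -> K) (S : seq T) (i :
    K) : Prop :=
  forall x y, x \notin S -> y \notin S -> x != y -> c x y = i.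

(** * Transfer to an arbitrary order of the four colours *)

Section Relabel.
Variables (T : finType) (c : T -> T -> 'I_4).
Hypothesis cC : forall x y, c x y = c y x.
Hypothesis cfree : rainbow_P5_free c.
Variables k0 k1 k2 k3 : 'I_4.
Let ks := [:: k0; k1; k2; k3].
Hypothesis ks_uniq : uniq ks.

Lemma mem_ks i : i \in ks.
Proof.
have card_ks : #|ks| = #|'I_4| by rewrite card_ord (card_uniqP ks_uniq).
by rewrite (elimT (subset_cardP card_ks) (subset_predT _) i).
Qed.

(** The position of the colour in [ks]. One numerical case analysis thus covers every permutation of
    the colours. *)
Definition relabel x y := index (c x y) ks.

Lemma relabelC x y : relabel x y = relabel y x.
Proof. by rewrite /relabel cC. Qed.

Lemma relabel4 x y : relabel x y < 4.
Proof. by rewrite -[4]/(size ks) index_mem mem_ks. Qed.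

Lemma relabelP x y (i : nat) : i < 4 -> relabel x y = i <-> c x y = nth k0 ks i.
Proof.
by move=> i4; split=> [<-|e]; rewrite ?nth_index ?mem_ks // /relabel e index_uniq.
Qed.

Lemma uniq_relabel (s : seq 'I_4) : uniq [seq index i ks | i <- s] = uniq s.
Proof.
apply: map_inj_in_uniq => i j _ _ e.
by rewrite -(nth_index k0 (mem_ks i)) e nth_index ?mem_ks.
Qed.

Lemma relabel_free : rainbow_P5_free relabel.
Proof.
move=> p q r s u /cfree.
by rewrite -uniq_relabel.
Qed.

Lemma two_colours_outside v a b e x y z : uniq [:: v; a; b; e; x; y; z] ->
  c v a = k1 -> c v b = k2 -> c v e = k3 -> c x y = k0 -> c y z <> k1.
Proof.
move=> U va vb ve xy yz.
by apply: (two_colours_outside_false relabelC relabel_free U); apply/relabelP.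
Qed.

Hypothesis no_free_edge : forall v a b e x y, uniq [:: v; a; b; e; x; y] ->
  ~~ uniq [:: c v a; c v b; c v e; c x y].

Lemma relabel_no_free_edge v a b e x y : uniq [:: v; a; b; e; x; y] ->
  ~~ uniq [:: relabel v a; relabel v b; relabel v e; relabel x y].
Proof. by move=> /no_free_edge; rewrite -uniq_relabel. Qed.

Lemma class_pair v a y b1 b2 b3 e : uniq [:: v; a; y; b1; b2; b3; e] ->
  c a y = k0 -> c v a = k1 -> c v y = k1 ->
  c v b1 = k2 -> c v b2 = k2 -> c v b3 = k2 -> c v e = k3 -> False.
Proof.
move=> U *.
by apply: (class_pair_false relabelC relabel4 relabel_free relabel_no_free_edge U);
  apply/relabelP.
Qed.
Lemma cross_pair23 v a y b e e' : uniq [:: v; a; y; b; e; e'] ->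
  c a y = k0 -> c v a = k1 -> c v y = k2 ->
  c v b = k2 -> c v e = k3 -> c v e' = k3 -> False.
Proof.
move=> U *.
by apply: (class23_false relabelC relabel4 relabel_free relabel_no_free_edge _ _ _ U);
  apply/relabelP.
Qed.

Lemma cross_pair223 v a y b1 b2 b3 e : uniq [:: v; a; y; b1; b2; b3; e] ->
  c a y = k0 -> c v a = k1 -> c v y = k2 ->
  c v b1 = k2 -> c v b2 = k2 -> c v b3 = k2 -> c v e = k3 -> False.
Proof.
move=> U *.
by apply: (class223_false relabelC relabel4 relabel_free relabel_no_free_edge _ _ _ U);
  apply/relabelP.
Qed.

Lemma cross_pair33 v a y e e' e'' : uniq [:: v; a; y; e; e'; e''] ->
  c a y = k0 -> c v a = k1 -> c v y = k2 ->
  c v e = k3 -> c v e' = k3 -> c v e'' = k3 -> c e e' = k3.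
Proof.
move=> U *.
apply/(relabelP _ _ (i := 3)) => //.
by apply: (class33_edge relabelC relabel4 relabel_free relabel_no_free_edge _ _ _ U);
  apply/relabelP.
Qed.
End Relabel.

(** * Three colours at a vertex leave an almost monochromatic colouring *)

Section NearMono.
Variables (T : finType) (c : T -> T -> 'I_4).
Hypothesis cC : forall x y, c x y = c y x.
Hypothesis cfree : rainbow_P5_free c.

Lemma fresh (s : seq T) : size s < #|T| -> exists x, x \notin s.
Proof.
move=> lt_s; apply/existsP; apply: contraTT lt_s => /existsPn all_s.
rewrite -leqNgt; apply: leq_trans (card_size s); apply/subset_leq_card/subsetP => x _.
exact/negPn.
Qed.

(** Any other colour of [yz] is that of [va], [vb] or [ve]; exchanging the leaves makes it the first
    of the three. *)
Lemma outside_step v a b e x y z : uniq [:: v; a; b; e; x; y; z] ->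
  uniq [:: c v a; c v b; c v e; c x y] -> c y z = c x y.
Proof.
move=> U K.
neqs U => *; neqs K => *.
have := @mem_ks (c x y) (c v a) (c v b) (c v e) _ (c y z).
rewrite !inE => /(_ ltac:(by split_neq; assumption)) /or4P[/eqP //|||] /eqP yz.
- by case: (@two_colours_outside _ c cC cfree (c x y) (c v a) (c v b) (c v e)
      _ v a b e x y z);
    try (by split_neq).
- by case: (@two_colours_outside _ c cC cfree (c x y) (c v b) (c v a) (c v e)
      _ v b a e x y z);
    try (by split_neq).
- by case: (@two_colours_outside _ c cC cfree (c x y) (c v e) (c v b) (c v a)
      _ v e b a x y z);
    try (by split_neq).
Qed.

(** The colour of the free edge spreads to all edges at [x] or [y] outside the star, and these are
    free in turn. *)
Lemma free_edge_mono_outside v a b e x y : uniq [:: v; a; b; e; x; y] ->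
  uniq [:: c v a; c v b; c v e; c x y] -> mono_outside c [:: v; a; b; e] (c x y).
Proof.
move=> U K p q pS qS npq.
have U' : uniq [:: v; a; b; e; y; x] by neqs U => *; split_neq.
have from_y z : z \notin [:: v; a; b; e; x; y] -> c y z = c x y.
  by move=> zU; apply: (@outside_step v a b e) => //; rewrite -(rot_uniq 6) cons_uniq zU.
have from_x z : z \notin [:: v; a; b; e; x; y] -> c x z = c x y.
  move=> zU; rewrite (cC x y); apply: (@outside_step v a b e); last by rewrite (cC y x).
  rewrite -(rot_uniq 6) cons_uniq U' andbT; move: zU; rewrite !inE.
  by rewrite orbA [(_ == x) || _]orbC -orbA.
have memS z : z \notin [:: v; a; b; e] -> z != x -> z != y ->
    z \notin [:: v; a; b; e; x; y].
  by rewrite !inE !negb_or => /and4P[-> -> -> ->] -> ->.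
have [px|npx] := eqVneq p x; first subst p.
  have [->//|nqy] := eqVneq q y.
  by apply/from_x/memS; rewrite // eq_sym.
have [py|npy] := eqVneq p y; first subst p.
  have [->//|nqx] := eqVneq q x.
  by apply/from_y/memS; rewrite // eq_sym.
have [->|nqx] := eqVneq q x; first by rewrite cC; apply/from_x/memS.
have [->|nqy] := eqVneq q y; first by rewrite cC; apply/from_y/memS.
have yp : c y p = c x y by apply/from_y/memS.
(* The edge [yp] is free, so it passes its colour on to [pq]. *)
rewrite -yp; apply: (@outside_step v a b e); last by rewrite yp.
move: pS qS; rewrite !inE !negb_or => /and4P[? ? ? ?] /and4P[? ? ? ?].
neqs U => *; split_neq; rewrite // eq_sym //.
Qed.

Definition near_mono := exists (S : seq T) i, size S <= 4 /\ mono_outside c S i.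

(** * No free edge: class [k1] of [v] lies inside an edge [xy] of the missing colour [k0] *)

Section NoFreeEdge.
Hypothesis no_free_edge : forall v a b e x y, uniq [:: v; a; b; e; x; y] ->
  ~~ uniq [:: c v a; c v b; c v e; c x y].
Variables (k0 k1 : 'I_4) (v x y : T).
Hypotheses (U : uniq [:: v; x; y]) (T8 : 8 <= #|T|).
Hypotheses (xy : c x y = k0) (vx : c v x = k1).
Hypothesis class1 : forall z, z != v -> c v z = k1 -> z \in [:: x; y].
Hypothesis class0 : forall z, z != v -> c v z <> k0.

Lemma class23 k2 k3 z : uniq [:: k0; k1; k2; k3] -> z \notin [:: v; x; y] ->
  c v z = k2 \/ c v z = k3.
Proof.
move=> K; rewrite inE negb_or => /andP[zv zxy].
have := mem_ks K (c v z); rewrite !inE => /or4P[] /eqP h; auto.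
  by case: (class0 zv).
by rewrite class1 in zxy.
Qed.

(** Besides [v], [x], [y] there are five vertices, all in classes [k2] and [k3]. Both classes are
    non-empty and one has three of the five, so [class_pair] applies, possibly with [k2] and [k3]
    exchanged. *)
Lemma covered_pair_false k2 k3 b e : uniq [:: k0; k1; k2; k3] -> c v y = k1 ->
  b != v -> c v b = k2 -> e != v -> c v e = k3 -> False.
Proof.
move=> K vy bv vb ev ve.
have K' : uniq [:: k0; k1; k3; k2] by neqs K => *; split_neq.
have neqk i j z z' : c v z = i -> c v z' = j -> i != j -> z != z'.
  by move=> <- <-; apply: contraNneq => ->.
have [z1 z1P] : exists z, z \notin [:: v; x; y; b; e]
  by apply: fresh; exact: leq_trans T8.
have [z2 z2P] : exists z, z \notin [:: v; x; y; b; e; z1]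
  by apply: fresh; exact: leq_trans T8.
have [z3 z3P] : exists z, z \notin [:: v; x; y; b; e; z1; z2]
  by apply: fresh; exact: leq_trans T8.
have UU : uniq [:: v; x; y; b; e; z1; z2; z3].
  neqs U => *; neqs z1P => *; neqs z2P => *; neqs z3P => *; neqs K => *.
  split_neq => //; by [apply: neqk vx vb _ | apply: neqk vx ve _ | apply: neqk vy vb _
    | apply: neqk vy ve _ | apply: neqk vb ve _ | rewrite eq_sym].
neqs UU => *.
have c1 : c v z1 = k2 \/ c v z1 = k3 by apply: class23 => //; split_neq.
have c2 : c v z2 = k2 \/ c v z2 = k3 by apply: class23 => //; split_neq.
have c3 : c v z3 = k2 \/ c v z3 = k3 by apply: class23 => //; split_neq.
case: c1 c2 c3 => e1 [] e2 [] e3;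
  first [ by apply: (class_pair cC cfree K no_free_edge (b1 := b) (b2 := z1) (b3 := z2)
          _ xy vx vy vb e1 e2 ve); split_neq
        | by apply: (class_pair cC cfree K no_free_edge (b1 := b) (b2 := z1) (b3 := z3)
                _ xy vx vy vb e1 e3 ve); split_neq
        | by apply: (class_pair cC cfree K no_free_edge (b1 := b) (b2 := z2) (b3 := z3)
                _ xy vx vy vb e2 e3 ve); split_neq
        | by apply: (class_pair cC cfree K' no_free_edge (b1 := e) (b2 := z1) (b3 := z2)
                _ xy vx vy ve e1 e2 vb); split_neq
        | by apply: (class_pair cC cfree K' no_free_edge (b1 := e) (b2 := z1) (b3 := z3)
                _ xy vx vy ve e1 e3 vb); split_neq
        | by apply: (class_pair cC cfree K' no_free_edge (b1 := e) (b2 := z2) (b3 := z3)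
                _ xy vx vy ve e2 e3 vb); split_neq].
Qed.

(** A further vertex [b] of class [k2] is impossible: two more vertices give either a second vertex
    of class [k3] or three of class [k2]. So all vertices outside [v], [x], [y] have class [k3], and
    the edges among them have colour [k3]. *)
Lemma covered_cross k2 k3 e : uniq [:: k0; k1; k2; k3] -> c v y = k2 ->
  e != v -> c v e = k3 -> near_mono.
Proof.
move=> K vy ev ve.
have neqk i j z z' : c v z = i -> c v z' = j -> i != j -> z != z'.
  by move=> <- <-; apply: contraNneq => ->.
have Ue : uniq [:: v; x; y; e].
  neqs K => *; neqs U => *; split_neq => //; [by rewrite eq_sym
    | by apply: neqk vx ve _ | by apply: neqk vy ve _].
have class3 b : b \notin [:: v; x; y] -> c v b = k3.
  move=> bP; case: (class23 K bP) => // vb.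
  have neb : b != e by neqs K => *; apply: neqk vb ve _.
  have [z1 z1P] : exists z, z \notin [:: v; x; y; b; e]
    by apply: fresh; exact: leq_trans T8.
  have [z2 z2P] : exists z, z \notin [:: v; x; y; b; e; z1]
    by apply: fresh; exact: leq_trans T8.
  have UU : uniq [:: v; x; y; b; e; z1; z2].
    neqs bP => *; neqs z1P => *; neqs z2P => *; neqs Ue => *.
    by split_neq => //; rewrite eq_sym.
  neqs UU => *.
  have c1 : c v z1 = k2 \/ c v z1 = k3 by apply: class23 => //; split_neq.
  have c2 : c v z2 = k2 \/ c v z2 = k3 by apply: class23 => //; split_neq.
  case: c1 c2 => e1 [] e2; exfalso;
  first [ by apply: (cross_pair223 cC cfree K no_free_edge (b1 := b) (b2 := z1) (b3 := z2)
          _ xy vx vy vb e1 e2 ve); split_neq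
        | by apply: (cross_pair23 cC cfree K no_free_edge (b := b) (e := e) (e' := z1)
                _ xy vx vy vb ve e1); split_neq
        | by apply: (cross_pair23 cC cfree K no_free_edge (b := b) (e := e) (e' := z2)
                _ xy vx vy vb ve e2); split_neq].
exists [:: v; x; y], k3; split=> // p q pP qP npq.
have [z zP] : exists z, z \notin [:: v; x; y; p; q]
  by apply: fresh; exact: leq_trans T8.
have zP' : z \notin [:: v; x; y] by neqs zP => *; split_neq.
apply: (cross_pair33 cC cfree K no_free_edge (e' := q) (e'' := z)
        _ xy vx vy); rewrite ?class3 //.
by neqs U => *; neqs pP => *; neqs qP => *; neqs zP => *; split_neq.
Qed.

Lemma covered_near_mono k2 k3 b e : uniq [:: k0; k1; k2; k3] ->
  b != v -> c v b = k2 -> e != v -> c v e = k3 -> near_mono.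
Proof.
move=> K bv vb ev ve.
have K' : uniq [:: k0; k1; k3; k2] by neqs K => *; split_neq.
have yv : y != v by neqs U => *.
have := mem_ks K (c v y); rewrite !inE => /or4P[] /eqP vy.
- by case: (class0 yv).
- by case: (covered_pair_false K vy bv vb ev ve).
- exact: covered_cross K vy ev ve.
- exact: covered_cross K' vy bv vb.
Qed.
End NoFreeEdge.

Lemma three_colours_near_mono v a b e : 8 <= #|T| ->
  (forall i, exists x y, x != y /\ c x y = i) ->
  uniq [:: v; a; b; e] -> uniq [:: c v a; c v b; c v e] -> near_mono.
Proof.
move=> T8 surj U K.
have [/existsP[v' /existsP[a' /existsP[b' /existsP[e'
     /existsP[x /existsP[y /andP[U' K']]]]]]]|]
  := boolP [exists v', exists a', exists b', exists e', exists x, exists y,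
    uniq [:: v'; a'; b'; e'; x; y] && uniq [:: c v' a'; c v' b'; c v' e'; c x y]].
  by exists [:: v'; a'; b'; e'], (c x y); split=> //; exact: free_edge_mono_outside.
move=> nofree.
have no_free_edge v' a' b' e' x y : uniq [:: v'; a'; b'; e'; x; y] ->
    ~~ uniq [:: c v' a'; c v' b'; c v' e'; c x y].
  move=> U'; apply: contraNN nofree => K'.
  apply/existsP; exists v'; apply/existsP; exists a'; apply/existsP; exists b'.
  apply/existsP; exists e'; apply/existsP; exists x; apply/existsP; exists y.
  by rewrite U'.
have [k0 k0P] : exists k0, k0 \notin [:: c v a; c v b; c v e].
  apply/existsP; apply: contraT => /existsPn all_k.
  have : #|'I_4| <= #|[:: c v a; c v b; c v e]|.
    by apply/subset_leq_card/subsetP => i _; apply/negPn.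
  by rewrite card_ord => /leq_trans /(_ (card_size _)).
have KK : uniq [:: k0; c v a; c v b; c v e] by rewrite cons_uniq k0P.
(* If [vz] had the missing colour, [z] could replace the leaf whose colour is that of an edge [xy]
   away from all these vertices, and [xy] would be free. *)
have class0 z : z != v -> c v z <> k0.
  move=> zv vz.
  have neqk i z' : c v z' = i -> k0 != i -> z != z'.
    by move=> <-; apply: contraNneq => <-; rewrite vz.
  neqs KK => *; neqs U => *.
  have U5 : uniq [:: v; a; b; e; z].
    by split_neq => //; rewrite eq_sym // (neqk _ _ erefl).
  have [x xP] : exists x, x \notin [:: v; a; b; e; z]
    by apply: fresh; exact: leq_trans T8.
  have [y yP] : exists y, y \notin [:: v; a; b; e; z; x]
    by apply: fresh; exact: leq_trans T8.
  have U7 : uniq [:: v; a; b; e; z; x; y].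
    by neqs U5 => *; neqs xP => *; neqs yP => *; split_neq => //; rewrite eq_sym.
  neqs U7 => *.
  have := mem_ks KK (c x y); rewrite !inE => /or4P[] /eqP xy.
  - by have := @no_free_edge v a b e x y; rewrite xy => /(_ _)/negP; apply; split_neq.
  - by have := @no_free_edge v z b e x y; rewrite xy vz => /(_ _)/negP; apply; split_neq.
  - by have := @no_free_edge v a z e x y; rewrite xy vz => /(_ _)/negP; apply; split_neq.
  - by have := @no_free_edge v a b z x y; rewrite xy vz => /(_ _)/negP; apply; split_neq.
have [x [y [nxy xy]]] := surj k0.
have xv : x != v.
  by apply/eqP => xv; apply: (@class0 y); rewrite -xv // eq_sym.
have yv : y != v.
  by apply/eqP => yv; apply: (@class0 x); rewrite // -yv cC.
pose covered k := [forall z, (z != v) && (c v z == k) ==> (z \in [:: x; y])].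
have coveredP k : covered k -> forall z, z != v -> c v z = k -> z \in [:: x; y].
  by move=> /forallP cov z zv vz; have := cov z; rewrite zv vz eqxx.
have uncovered k : ~~ covered k -> exists z, [/\ z != v, c v z = k & z \notin [:: x; y]].
  by case/forallPn => z; rewrite negb_imply -andbA => /and3P[? /eqP ? ?]; exists z.
have Uvxy : uniq [:: v; x; y] by split_neq; rewrite // eq_sym.
have Uvyx : uniq [:: v; y; x] by split_neq; rewrite // eq_sym.
have main k1 k2 k3 z1 z2 z3 : uniq [:: k0; k1; k2; k3] ->
    z1 != v -> c v z1 = k1 -> z2 != v -> c v z2 = k2 -> z3 != v -> c v z3 = k3 ->
    covered k1 -> near_mono.
  move=> K' z1v vz1 z2v vz2 z3v vz3 cov.
  have := coveredP _ cov _ z1v vz1; rewrite !inE => /orP[] /eqP ez1; subst z1.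
    exact (covered_near_mono no_free_edge Uvxy T8 xy vz1 (coveredP _ cov) class0 K'
      z2v vz2 z3v vz3).
  apply: (covered_near_mono no_free_edge Uvyx T8 _ vz1 _ class0 K' z2v vz2 z3v vz3).
    by rewrite cC.
  by move=> z zv vz; have := coveredP _ cov _ zv vz; rewrite !inE orbC.
neqs U => *; neqs KK => *.
have [cov|/uncovered[a' [a'v va' a'P]]] := boolP (covered (c v a)).
  by apply: (main _ _ _ a b e _ _ erefl _ erefl _ erefl cov); rewrite //; split_neq.
have [cov|/uncovered[b' [b'v vb' b'P]]] := boolP (covered (c v b)).
  by apply: (main _ _ _ b a e _ _ erefl _ erefl _ erefl cov); rewrite //; split_neq.
have [cov|/uncovered[e' [e'v ve' e'P]]] := boolP (covered (c v e)).
  by apply: (main _ _ _ e a b _ _ erefl _ erefl _ erefl cov); rewrite //; split_neq.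
have neqk i j z z' : c v z = i -> c v z' = j -> i != j -> z != z'.
  by move=> <- <-; apply: contraNneq => ->.
(* No class is covered by [x] and [y], so [v] has leaves of its three colours that avoid both, and
   [xy] is free. *)
have : uniq [:: v; a'; b'; e'; x; y].
  neqs Uvxy => *; neqs a'P => *; neqs b'P => *; neqs e'P => *.
  split_neq => //; first [by rewrite eq_sym | by apply: neqk va' vb' _ |
      by apply: neqk va' ve' _
    | by apply: neqk vb' ve' _].
by move=> /no_free_edge /negP[]; rewrite va' vb' ve' xy; split_neq; rewrite // eq_sym.
Qed.
End NearMono.

(** * Colourings in which every vertex sees at most two colours *)

Section Dominant.
Variables (T : finType) (c : T -> T -> 'I_4).
Hypothesis cC : forall x y, c x y = c y x.
Hypothesis surj : forall i, exists x y, x != y /\ c x y = i.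
Hypothesis local2 : forall v a b e, uniq [:: v; a; b; e] ->
  ~~ uniq [:: c v a; c v b; c v e].

Definition palette v := [set c v u | u in [set~ v]].

Lemma mem_palette x y : x != y -> c x y \in palette x.
Proof. by move=> xy; apply: imset_f; rewrite !inE eq_sym. Qed.

Lemma mem_palette_r x y : x != y -> c x y \in palette y.
Proof. by rewrite cC eq_sym; exact: mem_palette. Qed.

Lemma palette3 v i j k : i \in palette v -> j \in palette v -> k \in palette v ->
  ~~ uniq [:: i; j; k].
Proof.
case/imsetP=> a; rewrite !inE => av ->; case/imsetP=> b; rewrite !inE => bv ->.
case/imsetP=> e; rewrite !inE => ev ->; apply/negP => K.
have ne x y : c v x != c v y -> x != y by apply: contraNneq => ->.
have : uniq [:: v; a; b; e].
  neqs K => *; split_neq; first [by rewrite eq_sym | exact: ne].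
by move=> /local2 /negP.
Qed.

Lemma palette_mem3 v i j k : i \in palette v -> j \in palette v -> i != j ->
  k \in palette v -> k = i \/ k = j.
Proof.
move=> iv jv ij kv; have := palette3 iv jv kv; rewrite /= !inE !negb_or ij /=.
by rewrite !andbT negb_and !negbK => /orP[] /eqP ->; auto.
Qed.

Lemma exists_palette i : exists v, i \in palette v.
Proof. by have [x [y [/mem_palette + <-]]] := surj i; exists x. Qed.

Lemma palette_meet x y : x != y -> exists2 i, i \in palette x & i \in palette y.
Proof. by exists (c x y); [exact: mem_palette | exact: mem_palette_r]. Qed.

(** Pairwise meeting sets of at most two colours share a colour or form a triangle on three colours.
    The triangle is impossible because the fourth colour also lies in some palette, which must meet
    all the others. *)
Lemma common_colour : exists i, forall v, i \in palette v.
Proof.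
have star v u i j k l : uniq [:: i; j; k; l] -> i \in palette v -> j \in palette v ->
    i \in palette u -> k \in palette u -> forall z, i \in palette z.
  move=> K iv jv iu ku z; neqs K => *.
  have [w lw] := exists_palette l.
  have meet x y a b : x != y -> a \in palette x -> b \in palette x -> a != b ->
      a \in palette y \/ b \in palette y.
    move=> xy ax bx ab; have [m mx my] := palette_meet xy.
    by case: (palette_mem3 ax bx ab mx) => <-; auto.
  have neqp x y m a b : a \in palette x -> b \in palette x -> a != b -> m != a -> m != b ->
      m \in palette y -> x != y.
    move=> ax bx ab ma mb my; apply: contraTneq my => <-; apply/negP => mx.
    by case: (palette_mem3 ax bx ab mx) => e; [move: ma|move: mb]; rewrite e eqxx.
  have iw : i \in palette w.
    have vw : v != w by apply: (neqp _ _ l i j).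
    have uw : u != w by apply: (neqp _ _ l i k).
    case: (meet _ _ _ _ vw iv jv) => // jw.
    case: (meet _ _ _ _ uw iu ku) => // kw.
    by case/negP: (palette3 jw kw lw); split_neq.
  have [->//|zv] := eqVneq z v; have [->//|zu] := eqVneq z u.
  have [->//|zw] := eqVneq z w.
  rewrite eq_sym in zv; rewrite eq_sym in zu; rewrite eq_sym in zw.
  case: (meet _ _ _ _ zv iv jv) => // jz; case: (meet _ _ _ _ zu iu ku) => // kz.
  case: (meet _ _ _ _ zw iw lw) => // lz.
  by case/negP: (palette3 jz kz lz); split_neq.
have [v [i [j [ij iv jv]]]] : exists v i j, [/\ i != j, i \in palette v & j \in palette v].
  have [x [y [xy cxy]]] := surj ord0; have [z [w [zw czw]]] := surj ord_max.
  have := mem_palette xy; have := mem_palette zw; rewrite cxy czw => kz kx.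
  have [xz|xz] := eqVneq x z; first by subst z; exists x, ord0, ord_max.
  have := mem_palette xz; have := mem_palette_r xz.
  have [->|ne0] := eqVneq (c x z) ord0; first by exists z, ord0, ord_max.
  by exists x, (c x z), ord0.
have [k kP] : exists k, k \notin [:: i; j] by apply: fresh; rewrite card_ord.
have [l lP] : exists l, l \notin [:: i; j; k] by apply: fresh; rewrite card_ord.
have K : uniq [:: i; j; k; l].
  by neqs kP => *; neqs lP => *; split_neq; rewrite // eq_sym.
have [u uk] := exists_palette k.
have vu : v != u.
  apply: contraTneq uk => <-; apply/negP => vk.
  by case/negP: (palette3 iv jv vk); neqs K => *; split_neq.
have [m vm um] := palette_meet vu.
case: (palette_mem3 iv jv ij vm) => e; subst m.
  by exists i; exact: star K iv jv um uk.
by exists j; apply: (star v u j i k l); rewrite //; neqs K => *; split_neq.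
Qed.

(** Besides the common colour [i0] a vertex sees at most one colour, and that colour names its
    part. *)
Lemma dominant_colour : exists i0 (part : T -> 'I_4),
  [/\ forall x, part x != i0,
      forall x y, x != y -> c x y != i0 -> part x = c x y /\ part y = c x y
    & forall j, j != i0 -> exists x, part x = j].
Proof.
have [i0 i0P] := common_colour.
have [j0] : exists j, j \notin [:: i0] by apply: fresh; rewrite card_ord.
rewrite inE => j0P.
(* A vertex that sees only [i0] goes to the arbitrary part [j0]. *)
pose part x := odflt j0 [pick j in palette x | j != i0].
have partE x j : j \in palette x -> j != i0 -> part x = j.
  rewrite /part => jx ji; case: pickP => [m /andP[mx mi] /=|/(_ j)]; last by rewrite jx ji.
  have ij : i0 != j by rewrite eq_sym.
  by case: (palette_mem3 (i0P x) jx ij mx) => // e; rewrite e eqxx in mi.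
exists i0, part; split=> [x|x y xy ci|j ji].
- by rewrite /part; case: pickP => [m /andP[]|].
- by split; apply: partE => //; [exact: mem_palette | exact: mem_palette_r].
- by have [x xj] := exists_palette j; exists x; apply: partE.
Qed.
End Dominant.

(** * Matchings as lists of pairs *)

Fixpoint unpair (T : Type) (p : seq (T * T)) : seq T :=
  if p is q :: p' then q.1 :: q.2 :: unpair p' else [::].

Lemma size_unpair (T : Type) (p : seq (T * T)) : size (unpair p) = (size p).*2.
Proof. by elim: p => //= q p ->. Qed.

Lemma unpair_cat (T : Type) (p1 p2 : seq (T * T)) :
  unpair (p1 ++ p2) = unpair p1 ++ unpair p2.
Proof. by elim: p1 => //= q p ->. Qed.

Lemma nth_unpair (T : Type) (x0 : T) p i : i < size p ->
  nth (x0, x0) p i = (nth x0 (unpair p) i.*2, nth x0 (unpair p) i.*2.+1).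
Proof. by elim: p i => [|[a b] p IH] [|i] //= /IH. Qed.

Section Matching.
Variables (T : finType) (e : rel T).

Definition matching (p : seq (T * T)) := uniq (unpair p) && all (fun q => e q.1 q.2) p.

(** Remove edges greedily. If this stops before [k] edges, at most [k - 1] pairs are gone and what
    remains spans no edge. *)
Lemma matching_or_independent (C : {set T}) k : irreflexive e ->
  (exists p, [/\ matching p, size p = k & {subset unpair p <= C}]) \/
  (exists D : {set T}, [/\ D \subset C, {in D &, forall x y, ~~ e x y}
     & #|C| + 2 <= #|D| + k.*2]).
Proof.
move=> eirr; elim: k C => [|k IH] C; first by left; exists [::].
have [/existsP[x /existsP[y /and3P[xC yC xy]]]|noedge] :=
  boolP [exists x, exists y, [&& x \in C, y \in C & e x y]]; last first.
  right; exists C; split=> //; last by lia.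
  move=> x y xC yC; apply: contra noedge => xy.
  by apply/existsP; exists x; apply/existsP; exists y; rewrite xC yC.
have nxy : x != y by apply: contraTneq xy => ->; rewrite eirr.
have yCx : y \in C :\ x by rewrite !inE eq_sym nxy.
have := cardsD1 x C; rewrite xC (cardsD1 y (C :\ x)) yCx => cardC.
case: (IH ((C :\ x) :\ y)) => [[p [/andP[Up ep] sp pC]]|[D [DC De cD]]].
  left; exists ((x, y) :: p); split; last 2 first.
  - by rewrite /= sp.
  - move=> z; rewrite /= !inE => /or3P[/eqP->|/eqP->|/pC] //.
    by rewrite !inE => /and3P[].
  rewrite /matching /= xy ep Up !inE (negPf nxy) !andbT /=.
  by apply/andP; split; apply/negP => /pC; rewrite !inE eqxx ?andbF.
right; exists D; split=> //; last by lia.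
by apply: subset_trans DC _; rewrite !(subset_trans (subD1set _ _)).
Qed.

Lemma cross_matching (B C : {set T}) m : [disjoint B & C] -> {in B & C, forall x y, e x y} ->
  m <= #|B| -> m <= #|C| ->
  exists p, [/\ matching p, size p = m & {subset unpair p <= B :|: C}].
Proof.
elim: m B C => [|m IH] B C dBC eBC mB mC; first by exists [::].
have /card_gt0P[x xB] : 0 < #|B| by apply: leq_trans mB.
have /card_gt0P[y yC] : 0 < #|C| by apply: leq_trans mC.
have nxy : x != y by apply: contraTneq xB => ->; rewrite (disjointFl dBC).
have [||||p [/andP[Up ep] sp pBC]] := IH (B :\ x) (C :\ y).
- by apply: disjointWl (subD1set _ _) (disjointWr (subD1set _ _) dBC).
- by move=> a b; rewrite !inE => /andP[_ aB] /andP[_ bC]; apply: eBC.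
- by move: mB; rewrite (cardsD1 x B) xB.
- by move: mC; rewrite (cardsD1 y C) yC.
exists ((x, y) :: p); split; last 2 first.
- by rewrite /= sp.
- move=> z; rewrite /= !inE => /or3P[/eqP->|/eqP->|/pBC]; rewrite ?xB ?yC ?orbT //.
  by rewrite !inE => /orP[] /andP[_ ->]; rewrite ?orbT.
rewrite /matching /= eBC // ep Up !inE (negPf nxy) !andbT /=.
apply/andP; split; apply/negP => /pBC; rewrite !inE eqxx ?(disjointFr dBC xB);
  by rewrite ?(disjointFl dBC yC) ?andbF.
Qed.
End Matching.

(** * Monochromatic stars *)

Section MonoCopies.
Variables (n k : nat) (c : complete_graph n -> complete_graph n -> 'I_k).
Hypothesis cC : forall x y, c x y = c y x.

Lemma injective_is_copy (H : sgraph) (f : H -> complete_graph n) :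
  injective f -> is_copy f.
Proof.
move=> f_inj; split=> // x y xy; rewrite /adj /= /complete_adj.
by apply: contraTneq xy => /f_inj ->; rewrite adj_irrefl.
Qed.

Lemma clique_mono_copy (H : sgraph) (D : {set complete_graph n}) i :
  {in D &, forall x y, x != y -> c x y = i} -> #|H| <= #|D| -> has_mono_copy H c.
Proof.
move=> Di HD.
pose f (x : H) := enum_val (widen_ord HD (enum_rank x)).
have f_inj : injective f by move=> x y /enum_val_inj /(congr1 val)/= /val_inj /enum_rank_inj.
exists f; split; first exact: injective_is_copy.
exists i => x y xy; apply: Di; rewrite ?enum_valP //.
by apply: contraTneq xy => /f_inj ->; rewrite adj_irrefl.
Qed.

Lemma star_mono_copy t r v (U : {set complete_graph n}) p i : 0 < t ->
  v \notin U -> {in U, forall u, c v u = i} ->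
  matching (fun x y => c x y == i) p -> {subset unpair p <= U} ->
  r <= size p -> t <= #|U|.+1 -> has_mono_copy (star_graph t r) c.
Proof.
move=> t0 vU Ui /andP[Up pi] pU rp tU.
(* After the centre come the matched vertices pair by pair, then the others: positions 2j+1 and 2j+2
   hold the j-th pair, as in [star_arc]. *)
pose s := unpair p ++ [seq u <- enum U | u \notin unpair p].
have Us : uniq (v :: s).
  rewrite /= cat_uniq Up filter_uniq ?enum_uniq // mem_cat mem_filter mem_enum (negPf vU).
  rewrite andbF orbF (contra (@pU v) vU) /= andbT.
  by apply/hasPn => u; rewrite mem_filter => /andP[].
have sU u : u \in s = (u \in U).
  rewrite mem_cat mem_filter mem_enum; case: (boolP (u \in unpair p)) => //= /pU ->//.
have ss : size s = #|U|.
  have/andP[_ Us'] := Us; rewrite -(card_uniqP Us').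
  exact: eq_card.
pose f (x : star_graph t r) : complete_graph n := nth v (v :: s) (x : 'I_t).
have lt_f (x : 'I_t) : x < size (v :: s) by rewrite /= ss (leq_trans (ltn_ord x)).
have f_inj : injective f.
  by move=> x y /eqP; rewrite /f (nth_uniq v (lt_f x) (lt_f y) Us) => /eqP/val_inj.
exists f; split; first exact: injective_is_copy.
exists i.
have arc x y : star_arc r x y -> c (f x) (f y) = i.
  rewrite /star_arc => /orP[/andP[/eqP x0 y0]|/existsP[j /andP[/eqP xj /eqP yj]]].
    rewrite /f x0 /=; apply: Ui; rewrite -sU.
    case: y y0 (lt_f y) => [[|m] my] //= _ mt.
    by rewrite mem_nth.
  have jp : j < size p by apply: leq_trans rp.
  have := nth_unpair v jp; rewrite /f xj yj /= !nth_cat size_unpair.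
  rewrite ltn_double jp ltn_Sdouble jp => ej.
  by have := allP pi _ (mem_nth (v, v) jp); rewrite ej /= => /eqP.
by move=> x y /orP[/arc|/arc] //; rewrite cC.
Qed.
End MonoCopies.

(** * The star in a colouring with a dominant colour *)

Section Extremal.
Variables (n : nat) (c : complete_graph n -> complete_graph n -> 'I_4).
Hypothesis cC : forall x y, c x y = c y x.
Variables (s r : nat).
Hypotheses (rs : r < s) (n1 : 3 * s - 1 <= n) (n2 : 2 * s + 2 * r - 1 <= n).

Lemma dominant_mono_copy i0 j1 j2 j3 (part : complete_graph n -> 'I_4) :
  uniq [:: i0; j1; j2; j3] -> (forall x, part x != i0) ->
  (forall x y, x != y -> c x y != i0 -> part x = c x y /\ part y = c x y) ->
  0 < #|[set x | part x == j1]| ->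
  #|[set x | part x == j1]| <= #|[set x | part x == j2]| <= #|[set x | part x == j3]| ->
  has_mono_copy (star_graph (2 * s).+1 r) c.
Proof.
set P1 := [set x | _]; set P2 := [set x | _]; set P3 := [set x | _].
move=> K pi0 pc P1_gt0 /andP[P12 P23].
have cross x y : part x != part y -> c x y = i0.
  move=> xy; apply/eqP; apply: contraTT (xy) => cxy; have nxy : x != y
      by apply: contraNneq xy => ->.
  by have [-> ->] := pc _ _ nxy cxy; rewrite eqxx.
have memP x : [|| x \in P1, x \in P2 | x \in P3].
  by have := mem_ks K (part x); rewrite !inE (negPf (pi0 x)).
have dis i j : i != j -> [set x | part x == i] :&: [set x | part x == j] = set0.
  move=> ij; apply/setP => x; rewrite !inE; apply: contraNF ij => /andP[/eqP <- /eqP <-] //.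
have card_parts : #|P1| + (#|P2| + #|P3|) = n.
  neqs K => *.
  transitivity #|[set: complete_graph n]|; last by rewrite cardsT card_ord.
  have -> : setT = P1 :|: (P2 :|: P3) by apply/setP => x; rewrite !in_setU memP inE.
  by rewrite !cardsU setIUr !dis // setU0 cards0 !subn0.
have [v vP1] : exists v, v \in P1 by apply/card_gt0P.
pose U := P2 :|: P3.
have cardU : #|U| = #|P2| + #|P3|.
  by neqs K => *; rewrite /U cardsU dis // cards0 subn0.
have vU : v \notin U.
  neqs K => *; move: vP1; rewrite /U !inE => /eqP ->; exact/andP.
have Ui : {in U, forall u, c v u = i0}.
  by move=> u uU; apply: cross; apply: contraNneq vU => e; move: uU; rewrite /U !inE e.
have irr : irreflexive [rel x y | (x != y) && (c x y == i0)] by move=> x; rewrite /= eqxx.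
(* In the second case |D| >= |P3| + 2|P2| + 2 - 2r >= n + 2 - 2r >= 2s + 1, as |P1| <= |P2|; [D] has
   no edge of colour [i0], hence is a clique of colour [j3]. *)
have [[p [/andP[Up ep] sp pP3]]|[D [DP3 De cD]]] :=
    matching_or_independent P3 (r - #|P2|) irr; last first.
  apply: (@clique_mono_copy _ _ _ _ D j3);
    last by have := subset_leq_card DP3; rewrite card_ord; lia.
  move=> x y xD yD nxy; have := De _ _ xD yD; rewrite /= nxy => /(pc _ _ nxy) [<- _].
  by have /subsetP/(_ _ xD) := DP3; rewrite inE => /eqP.
pose C := P3 :\: [set x in unpair p].
have cardC : #|P3| <= #|C| + (r - #|P2|).*2.
  have := cardsID [set x in unpair p] P3; rewrite -/C -sp -size_unpair => <-.
  rewrite addnC leq_add2l; apply: leq_trans (card_size (unpair p)).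
  by apply/subset_leq_card/subsetP => x; rewrite !inE => /andP[].
(* With truncated subtraction the number of cross edges is min(r, |P2|), which completes [p] to [r]
   edges. *)
have [||||q [/andP[Uq eq] sq qPC]] :=
  @cross_matching _ (fun x y => c x y == i0) P2 C (r - (r - #|P2|)).
- apply: disjointWr (subsetDl _ _) _; rewrite -setI_eq0 dis //; by neqs K.
- move=> x y; rewrite !inE => /eqP xj /andP[_ /eqP yj]; apply/eqP/cross.
  by rewrite xj yj; neqs K.
- by lia.
- by lia.
apply: (@star_mono_copy _ _ _ cC _ _ v U (p ++ q) i0) => //; last first.
(* The smallest part has at most n/3 vertices, so n >= 3s - 1 leaves at least 2s in [U]. *)
- by rewrite cardU; lia.
- by rewrite size_cat; lia.
- move=> x; rewrite unpair_cat mem_cat in_setU => /orP[/pP3 ->|/qPC]; first by rewrite orbT.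
  by rewrite in_setU in_setD => /orP[->|/andP[_ ->]]; rewrite ?orbT.
rewrite /matching unpair_cat cat_uniq Up Uq all_cat eq !andbT /=; apply/andP; split.
  apply/hasPn => x /qPC; rewrite in_setU in_setD => /orP[xP2|/andP[]]; last by rewrite inE.
  apply/negP => /pP3 xP3; have : x \in P2 :&: P3 by rewrite inE xP2.
  by rewrite dis ?inE //; neqs K.
by apply: sub_all ep => x /andP[].
Qed.
End Extremal.

(** * The upper bound *)

Section Upper.
Variables (n : nat) (c : complete_graph n -> complete_graph n -> 'I_4).
Hypothesis cC : forall x y, c x y = c y x.

Lemma rainbow_path_copy p q r s u : uniq [:: p; q; r; s; u] ->
  uniq [:: c p q; c q r; c r s; c s u] -> has_rainbow_copy (path_graph 5) c.
Proof.
set vs := [:: p; _; _; _; _] => U; set cs := [:: _; _; _; _] => K.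
pose f (x : path_graph 5) : complete_graph n := nth p vs (x : 'I_5).
have f_inj : injective f.
  by move=> x y /eqP; rewrite /f (nth_uniq p _ _ U) // => /eqP/val_inj.
exists f; split; first exact: injective_is_copy.
have arcE (x y : 'I_5) : path_arc x y -> x < 4 /\ c (f x) (f y) = nth (c p q) cs x.
  rewrite /path_arc /f => /eqP xy; have := ltn_ord y; rewrite xy => x4; split=> //.
  by case: (x : nat) x4 => [|[|[|[|]]]].
have arc_inj (x y a b : 'I_5) : path_arc x y -> path_arc a b ->
    c (f x) (f y) = c (f a) (f b) -> x = a /\ y = b.
  move=> xy ab; have [x4 ->] := arcE _ _ xy; have [a4 ->] := arcE _ _ ab.
  move/eqP; rewrite (nth_uniq _ _ _ K) // => /eqP xa.
  split; apply: val_inj => //=; move: xy ab; rewrite /path_arc.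
  by move=> /eqP -> /eqP ->; rewrite xa.
move=> x y a b /orP[] xy /orP[] ab.
- by case/(arc_inj _ _ _ _ xy ab) => -> ->.
- by rewrite (cC (f a)) => /(arc_inj _ _ _ _ xy ab)[-> ->]; rewrite setUC.
- by rewrite (cC (f x)) => /(arc_inj _ _ _ _ xy ab)[-> ->]; rewrite setUC.
- by rewrite (cC (f x)) (cC (f a)) => /(arc_inj _ _ _ _ xy ab)[-> ->].
Qed.

Lemma rainbow_or_mono s r : exact_coloring c -> 3 <= r -> r < s ->
  3 * s - 1 <= n -> 2 * s + 2 * r - 1 <= n ->
  has_rainbow_copy (path_graph 5) c \/ has_mono_copy (star_graph (2 * s).+1 r) c.
Proof.
move=> [_ surj] r3 rs n1 n2.
have [/existsP[p /existsP[q /existsP[a /existsP[b /existsP[u /andP[U K]]]]]]|norb] :=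
  boolP [exists p : complete_graph n, exists q : complete_graph n,
     exists a : complete_graph n, exists b : complete_graph n, exists u : complete_graph n,
    uniq [:: p; q; a; b; u] && uniq [:: c p q; c q a; c a b; c b u]].
  by left; apply: rainbow_path_copy U K.
have cfree : rainbow_P5_free c.
  move=> p q a b u U; apply: contraNN norb => K.
  apply/existsP; exists p; apply/existsP; exists q; apply/existsP; exists a.
  by apply/existsP; exists b; apply/existsP; exists u; rewrite U.
right.
have [/existsP[v /existsP[a /existsP[b /existsP[e /andP[U K]]]]]|no3] :=
  boolP [exists v : complete_graph n, exists a : complete_graph n,
     exists b : complete_graph n, exists e : complete_graph n,
    uniq [:: v; a; b; e] && uniq [:: c v a; c v b; c v e]].
  have [|S [i [S4 Si]]] := three_colours_near_mono cC cfree _ surj U K.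
    by rewrite card_ord; lia.
  apply: (@clique_mono_copy _ _ _ _ (~: [set x in S]) i).
    by move=> x y; rewrite !inE; exact: Si.
  (* Since r >= 3, n - 4 >= 2s + 2r - 5 >= 2s + 1, the order of the star. *)
  have Sc : #|[set x in S]| <= 4 by rewrite cardsE; exact: leq_trans (card_size S) S4.
  by have := cardsC [set x in S]; rewrite !card_ord; lia.
have local2 v a b e : uniq [:: v; a; b; e] -> ~~ uniq [:: c v a; c v b; c v e].
  move=> U; apply: contraNN no3 => K.
  apply/existsP; exists v; apply/existsP; exists a; apply/existsP; exists b.
  by apply/existsP; exists e; rewrite U.
have [i0 [part [pi0 pc psurj]]] := dominant_colour cC surj local2.
have [j1 j1P] : exists j, j \notin [:: i0] by apply: fresh; rewrite card_ord.
have [j2 j2P] : exists j, j \notin [:: i0; j1] by apply: fresh; rewrite card_ord.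
have [j3 j3P] : exists j, j \notin [:: i0; j1; j2] by apply: fresh; rewrite card_ord.
pose P j := [set x | part x == j].
have main k1 k2 k3 : uniq [:: i0; k1; k2; k3] -> #|P k1| <= #|P k2| <= #|P k3| ->
    has_mono_copy (star_graph (2 * s).+1 r) c.
  move=> K; apply: (dominant_mono_copy cC rs n1 n2 K pi0 pc).
  have [x xk] : exists x, part x = k1 by apply: psurj; neqs K.
  by apply/card_gt0P; exists x; rewrite inE xk.
neqs j1P => *; neqs j2P => *; neqs j3P => *.
case/orP: (leq_total #|P j1| #|P j2|) => h12; case/orP: (leq_total #|P j2| #|P j3|) => h23;
  case/orP: (leq_total #|P j1| #|P j3|) => h13;
  first [ by apply: (main j1 j2 j3); [split_neq | exact/andP]
        | by apply: (main j1 j3 j2); [split_neq | exact/andP]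
        | by apply: (main j2 j1 j3); [split_neq | exact/andP]
        | by apply: (main j2 j3 j1); [split_neq | exact/andP]
        | by apply: (main j3 j1 j2); [split_neq | exact/andP]
        | by apply: (main j3 j2 j1); [split_neq | exact/andP]].
Qed.
End Upper.

(** * Lower bound *)

Section Lower.
Variables (n r t : nat) (part : 'I_n -> 'I_4).
Let P j := [set x | part x == j].
Hypotheses (t0 : 0 < t) (rt : 2 * r < t).
Hypothesis part_neq0 : forall x, part x != ord0.
Hypothesis P_gt1 : forall j, j != ord0 -> 1 < #|P j|.
Hypothesis P_lt : forall j, #|P j| < t.
(** Two obstructions to a star of colour 0 centred in part [j]: too few vertices outside the part,
    or another part too small to meet all [r] triangles. *)
Hypothesis P_centre : forall j, j != ord0 ->
  #|~: P j| < t.-1 \/ exists i, [/\ i != ord0, i != j & #|P i| < r].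

Definition part_colouring (x y : complete_graph n) : 'I_4 :=
  if part x == part y then part x else ord0.

Local Notation c := part_colouring.

Lemma part_colouring_exact : exact_coloring c.
Proof.
split=> [x y _|i]; first by rewrite /part_colouring eq_sym; case: eqP.
have [->|i0] := eqVneq i ord0; last first.
  have /card_gt1P[x [y [xi yi xy]]] := P_gt1 i0; exists x, y; split=> //.
  by move: xi yi; rewrite !inE /part_colouring => /eqP -> /eqP ->; rewrite eqxx.
have nonempty j : j != ord0 -> exists x, part x = j.
  move=> /P_gt1 /ltnW /card_gt0P[x]; rewrite inE => /eqP <-; by exists x.
have [x xP] := nonempty (@Ordinal 4 1 isT) isT.
have [y yP] := nonempty (@Ordinal 4 2 isT) isT.
exists x, y; split; last by rewrite /part_colouring xP yP.
by apply/eqP => xy; move: xP; rewrite xy yP.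
Qed.

Lemma part_colouring_neq0 x y : c x y != ord0 -> part x = c x y /\ part y = c x y.
Proof. by rewrite /part_colouring; have [->|] := eqVneq (part x) (part y). Qed.

(** Two adjacent edges of non-zero colour both take the colour of the part of their common vertex.
    Hence each half of a rainbow path has an edge of colour 0, and that colour repeats. *)
Lemma part_colouring_no_rainbow : ~ has_rainbow_copy (path_graph 5) c.
Proof.
case=> f [_ rb].
pose o i (h : i < 5) : path_graph 5 := Ordinal h.
pose x0 := @o 0 isT; pose x1 := @o 1 isT; pose x2 := @o 2 isT.
pose x3 := @o 3 isT; pose x4 := @o 4 isT.
have rbe (x y a b : path_graph 5) : adj x y -> adj a b -> x \notin [set a; b] ->
    c (f x) (f y) != c (f a) (f b).
  move=> xy ab; apply: contraNneq => /(rb _ _ _ _ xy ab) <-.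
  by rewrite !inE eqxx.
have consec (x y z : path_graph 5) : adj x y -> adj y z -> x \notin [set y; z] ->
    c (f x) (f y) = ord0 \/ c (f y) (f z) = ord0.
  move=> xy yz xyz; have := rbe _ _ _ _ xy yz xyz.
  have [|/part_colouring_neq0[_ <-]] := eqVneq (c (f x) (f y)) ord0; first by left.
  have [|/part_colouring_neq0[-> _]] := eqVneq (c (f y) (f z)) ord0; first by right.
  by rewrite eqxx.
have ne01 : c (f x0) (f x1) != c (f x2) (f x3) by apply: rbe; rewrite ?inE.
have ne02 : c (f x0) (f x1) != c (f x3) (f x4) by apply: rbe; rewrite ?inE.
have ne12 : c (f x1) (f x2) != c (f x2) (f x3) by apply: rbe; rewrite ?inE.
have ne13 : c (f x1) (f x2) != c (f x3) (f x4) by apply: rbe; rewrite ?inE.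
have [||||] := consec x0 x1 x2; rewrite ?inE // => ea;
have [||||] := consec x2 x3 x4; rewrite ?inE // => eb.
all: by rewrite ea eb eqxx in ne01 ne02 ne12 ne13.
Qed.

(** In a non-zero colour the star lies inside one part, which is too small. In colour 0 every
    triangle has a vertex in each of the three parts. *)
Lemma part_colouring_no_mono : ~ has_mono_copy (star_graph t r) c.
Proof.
case=> f [[f_inj _] [i fi]].
pose v0 : 'I_t := Ordinal t0.
have cardE : #|[set f x | x : star_graph t r]| = t.
  by rewrite card_imset // card_ord.
have leaf (x : 'I_t) : x != v0 -> c (f v0) (f x) = i.
  by move=> x0; apply: fi; rewrite /adj /= /sym_adj /star_arc /= x0.
have [i0|i_neq0] := eqVneq i ord0; last first.
  have := P_lt i; rewrite ltnNge -{1}cardE => /negP; apply.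
  have t1 : 1 < t by move: (P_gt1 i_neq0) (P_lt i); exact: ltn_trans.
  have centre : part (f v0) = i.
    have x1 : Ordinal t1 != v0 by [].
    by have := leaf _ x1 => e; rewrite -e in i_neq0 *; case: (part_colouring_neq0 i_neq0).
  apply/subset_leq_card/subsetP => _ /imsetP[x _ ->]; rewrite inE.
  have [->|/leaf e] := eqVneq (x : 'I_t) v0; first by rewrite centre.
  by rewrite -e in i_neq0 *; case: (part_colouring_neq0 i_neq0) => _ ->.
have cross x y : c x y = ord0 -> part x != part y.
  rewrite /part_colouring; have [_ e|//] := eqVneq (part x) (part y).
  by have := part_neq0 x; rewrite e.
case: (P_centre (part_neq0 (f v0))) => [|[j [j0 jv Pj]]].
  rewrite ltnNge => /negP; apply.
  have -> : t.-1 = #|f @: [set~ v0]|.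
    by rewrite card_imset // cardsC1 card_ord.
  apply/subset_leq_card/subsetP => _ /imsetP[x xv ->]; rewrite !inE in xv *.
  by rewrite eq_sym; apply: cross; rewrite leaf.
have lt1 (k : 'I_r) : k.*2.+1 < t by have := ltn_ord k; lia.
have lt2 (k : 'I_r) : k.*2.+2 < t by have := ltn_ord k; lia.
(* The vertex of the k-th triangle in the small part [j]; different triangles share only the centre,
   so [g] injects [r] indices into that part. *)
pose g (k : 'I_r) := if part (f (Ordinal (lt1 k))) == j then f (Ordinal (lt1 k))
  else f (Ordinal (lt2 k)).
have g_inj : injective g.
  move=> k k'; rewrite /g; case: ifP => _; case: ifP => _ /f_inj /(congr1 val) /= e;
    by apply: val_inj => /=; lia.
move: Pj; rewrite ltnNge => /negP; apply.
rewrite -[r]card_ord -(card_imset _ g_inj).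
apply/subset_leq_card/subsetP => _ /imsetP[k _ ->]; rewrite inE /g; case: ifP => // kj.
have := cross (f (Ordinal (lt1 k))) (f (Ordinal (lt2 k))).
have -> : c (f (Ordinal (lt1 k))) (f (Ordinal (lt2 k))) = ord0.
  rewrite fi ?i0 // /adj /= /sym_adj /star_arc /=.
  by apply/orP; left; apply/existsP; exists k; rewrite !eqxx.
have v1 : part (f v0) != part (f (Ordinal (lt1 k))) by apply: cross; rewrite leaf.
have v2 : part (f v0) != part (f (Ordinal (lt2 k))) by apply: cross; rewrite leaf.
move=> /(_ erefl); move: v1 v2 kj j0 jv; rewrite -!val_eqE /=.
move: (part_neq0 (f v0)) (part_neq0 (f (Ordinal (lt1 k)))) (part_neq0 (f (Ordinal (lt2 k)))).
rewrite -!val_eqE /=.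
move: (ltn_ord (part (f v0))) (ltn_ord (part (f (Ordinal (lt1 k)))))
  (ltn_ord (part (f (Ordinal (lt2 k))))) (ltn_ord j).
lia.
Qed.
End Lower.

Lemma card_ord_seq n (A : {set 'I_n}) (l : seq nat) :
  {in A, forall x : 'I_n, val x \in l} -> #|A| <= size l.
Proof.
move=> Al; rewrite cardE -(size_map val); apply: uniq_leq_size.
  by rewrite (map_inj_uniq val_inj) enum_uniq.
by move=> _ /mapP[x xA ->]; apply: Al; rewrite mem_enum in xA.
Qed.

Definition interval_part n p q (x : 'I_n) : 'I_4 :=
  if x < p then @Ordinal 4 1 isT else if x < p + q then @Ordinal 4 2 isT
  else @Ordinal 4 3 isT.

(** Consecutive intervals of [p], [q], [w] vertices serve as parts. Each has at least two vertices
    so that its colour occurs; the three disjunctions are [P_centre] for the three possible parts of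
    the centre. *)
Lemma three_parts_lower p q w r t :
  1 < p < t -> 1 < q < t -> 1 < w < t -> 2 * r < t ->
  [|| q + w < t.-1, q < r | w < r] -> [|| p + w < t.-1, p < r | w < r] ->
  [|| p + q < t.-1, p < r | q < r] ->
  ~ gallai_ramsey_bound 4 (path_graph 5) (star_graph t r) (p + q + w).
Proof.
move=> pt qt wt rt c1 c2 c3 [_ /(_ _ (leqnn _))].
set n := p + q + w; set part := @interval_part n p q.
have t0 : 0 < t by lia.
pose P j := [set x | part x == j].
have P1 : #|P (@Ordinal 4 1 isT)| <= p.
  rewrite -(size_iota 0 p); apply: card_ord_seq => x; rewrite inE mem_iota.
  by rewrite /part /interval_part; case: ltnP => //; case: ltnP.
have P2 : #|P (@Ordinal 4 2 isT)| <= q.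
  rewrite -(size_iota p q); apply: card_ord_seq => x; rewrite inE mem_iota.
  by rewrite /part /interval_part /=; case: (ltnP x p) => // _; case: ltnP.
have P3 : #|P (@Ordinal 4 3 isT)| <= w.
  rewrite -(size_iota (p + q) w); apply: card_ord_seq => x; rewrite inE mem_iota.
  by rewrite /part /interval_part ltn_ord andbT; case: (ltnP x p) => // _; case: ltnP.
have part_neq0 x : part x != ord0 by rewrite /part /interval_part; case: ltnP => //;
    case: ltnP.
have o4 (j : 'I_4) : j != ord0 ->
    [\/ j = @Ordinal 4 1 isT, j = @Ordinal 4 2 isT | j = @Ordinal 4 3 isT].
  by case: j => [[|[|[|[|]]]]] // h _; [constructor 1|constructor 2|constructor 3];
      apply: val_inj.
have co i j k : (forall x, [|| part x == i, part x == j | part x == k]) ->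
    #|~: P i| <= #|P j| + #|P k|.
  move=> ijk; apply: leq_trans (leq_of_leqif (leq_card_setU _ _));
      apply/subset_leq_card/subsetP => x.
  by rewrite !inE; case/orP: (ijk x) => ->.
have P_gt1 j : j != ord0 -> 1 < #|P j|.
  have two a b (a_n : a < n) (b_n : b < n) : a != b -> part (Ordinal a_n) = j ->
      part (Ordinal b_n) = j -> 1 < #|P j|.
    move=> ab pa pb; apply/card_gt1P; exists (Ordinal a_n), (Ordinal b_n).
    by split; rewrite ?inE ?pa ?pb.
  (* The first two vertices of each interval. *)
  have h0 : 0 < n by lia. have h1 : 1 < n by lia.
  have h2 : p < n by lia. have h3 : p.+1 < n by lia.
  have h4 : p + q < n by lia. have h5 : (p + q).+1 < n by lia.
  by case/o4 => e; subst j; [apply: (two _ _ h0 h1) | apply: (two _ _ h2 h3) |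
      apply: (two _ _ h4 h5)];
    rewrite ?/part /interval_part /=; try lia; case: ltnP => // *; try lia;
        case: ltnP => // *; lia.
have P_lt j : #|P j| < t.
  have [->|/o4[] ->] := eqVneq j ord0; [|lia|lia|lia].
  by rewrite (_ : P _ = set0) ?cards0 //; apply/setP => x; rewrite !inE (negPf (part_neq0 x)).
have P_centre j : j != ord0 ->
    #|~: P j| < t.-1 \/ exists i, [/\ i != ord0, i != j & #|P i| < r].
  case/o4 => ->.
  - case/or3P: c1 => h; [left|right; exists (@Ordinal 4 2 isT)|right;
      exists (@Ordinal 4 3 isT)].
    + apply: leq_ltn_trans (co _ (@Ordinal 4 2 isT) (@Ordinal 4 3 isT) _) _; last by lia.
      by move=> x; case: (o4 _ (part_neq0 x)) => ->.
    + by split=> //; lia.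
    + by split=> //; lia.
  - case/or3P: c2 => h; [left|right; exists (@Ordinal 4 1 isT)|right;
      exists (@Ordinal 4 3 isT)].
    + apply: leq_ltn_trans (co _ (@Ordinal 4 1 isT) (@Ordinal 4 3 isT) _) _; last by lia.
      by move=> x; case: (o4 _ (part_neq0 x)) => ->.
    + by split=> //; lia.
    + by split=> //; lia.
  - case/or3P: c3 => h; [left|right; exists (@Ordinal 4 1 isT)|right;
      exists (@Ordinal 4 2 isT)].
    + apply: leq_ltn_trans (co _ (@Ordinal 4 1 isT) (@Ordinal 4 2 isT) _) _; last by lia.
      by move=> x; case: (o4 _ (part_neq0 x)) => ->.
    + by split=> //; lia.
    + by split=> //; lia.
move=> /(_ (part_colouring part) (part_colouring_exact P_gt1))[].
  exact: part_colouring_no_rainbow.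
exact: part_colouring_no_mono.
Qed.

Theorem theorem3p4 (r t : nat) (hr : 3 <= r) (ht : odd t) :
  (3 <= r <= (t - 1) %/ 4 ->
     is_gallai_ramsey 4 (path_graph 5) (star_graph t r) ((3 * t - 5) %/ 2)) /\
  (ceil_div (t - 1) 4 <= r <= (t - 3) %/ 2 ->
     is_gallai_ramsey 4 (path_graph 5) (star_graph t r) (t + 2 * r - 2)).
Proof.
have [s ts] : exists s, t = (2 * s).+1 by exists t./2; lia.
subst t.
have bound N : r < s -> 3 * s - 1 <= N -> 2 * s + 2 * r - 1 <= N ->
    gallai_ramsey_bound 4 (path_graph 5) (star_graph (2 * s).+1 r) N.
  move=> rs N1 N2; split.
    by apply: (@leq_trans 'C(4, 2)) => //; apply: leq_bin2l; lia.
  move=> n Nn c c_exact.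
  have cC x y : c x y = c y x.
    have [->//|xy] := eqVneq x y; exact: (proj1 c_exact).
  by apply: rainbow_or_mono; rewrite //; lia.
split=> rt.
(* Here 2r <= s. With parts s, s - 1, s - 1 a vertex has at most 2s - 1 neighbours in other parts,
   one fewer than a centre needs. *)
- have -> : (3 * (2 * s).+1 - 5) %/ 2 = (s + (s - 1) + (s - 1)).+1 by lia.
  split; first by apply: bound; lia.
  move=> M [M4 HM]; rewrite ltnNge; apply/negP => Mlt.
  (* A smaller bound [M] would also be a bound at the order of this colouring. *)
  have [] := @three_parts_lower s (s - 1) (s - 1) r (2 * s).+1; try lia.
  split; last by move=> n nN; apply: HM; exact: leq_trans nN.
  by apply: leq_trans M4 (leq_bin2l _ Mlt).
(* Here 2r >= s. With parts r - 1, r - 1, 2s, wherever the centre lies, another part has fewer than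
   [r] vertices. *)
- have -> : (2 * s).+1 + 2 * r - 2 = (r - 1 + (r - 1) + 2 * s).+1
    by rewrite /ceil_div in rt; lia.
  split; first by rewrite /ceil_div in rt; apply: bound; lia.
  move=> M [M4 HM]; rewrite ltnNge; apply/negP => Mlt.
  have [] := @three_parts_lower (r - 1) (r - 1) (2 * s) r (2 * s).+1; try lia.
  split; last by move=> n nN; apply: HM; exact: leq_trans nN.
  by apply: leq_trans M4 (leq_bin2l _ Mlt).
Qed.
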